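(* Let $X_m$ be a birth-death chain on the integers with transition probabilities $r_n, l_n, a_n$ (possibly with absorbing states), and let $G$ be its Green's function, as described in the context. Let $j<k$ be integers which are admissible initial points of the chain, as described in the context. If the chain $X_m$ is recurrent, then $G(j,k) = G(k,j) = \infty$. If $X_m$ is transient, then $$\frac{G(j,k)}{G(k,j)} = \frac{r_{j}\, r_{j+1} \cdots r_{k-1}}{l_{j+1}\, l_{j+2} \cdots l_{k}}.$$
   Context: A birth-death chain $X_m$ ($m=0,1,2,\dots$) is a Markov chain taking values in $\mathbb{Z}$ with transition probabilities $p_{n,n+1}=r_n$, $p_{n,n-1}=l_n$, $p_{n,n}=a_n$, and $p_{n,i}=0$ if $|n-i|>1$, where $l_n+r_n+a_n=1$. It is assumed throughout that $r_n>0$ and $l_n>0$ for all $n$. Absorbing states: the chain is allowed (but not required) to have absorbing states $A$ and/or $B$ in $\mathbb{Z}$ at which it is killed. Let $\tau=\inf\{m' : X_{m'} \in\{A,B\}\}$ be the first time the chain reaches an absorbing state (with only the one state used if only one is present); $\tau=\infty$ if the chain never reaches an absorbing state, or if no absorbing states are present. For all $m\ge\tau$ one sets $X_m=\Delta$, where $\Delta$ is a cemetery point not in $\mathbb{Z}$. Admissible initial points: if there are two absorbing states $A<B$, the initial points $j,k$ satisfy $A<j,k<B$; if there is only one absorbing state, then $j,k$ both lie strictly on the same side of it; if there are none, $j,k$ are arbitrary integers. The Green's function is $$G(x,y)=E_x\sum_{m=0}^{\tau}1_{\{X_m=y\}},$$ the expected number of visits to $y$, before time $\tau$, of the chain started at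 $x$. Recurrence and transience refer to the (possibly killed) chain; in particular a chain with an absorbing state, being killed there, is transient. *)

(* Defs.v *)
From mathcomp Require Import all_boot all_order all_algebra.
From mathcomp Require Import all_classical all_reals all_analysis.

Set Implicit Arguments.
Unset Strict Implicit.
Unset Printing Implicit Defensive.

Import Order.TTheory GRing.Theory Num.Theory.

Local Open Scope classical_set_scope.
Local Open Scope ring_scope.

Definition birth_death_rates (R : realType) (r l a : int -> R) : Prop :=
  forall n, [/\ 0 < r n, 0 < l n, 0 <= a n & l n + r n + a n = 1].

Definition birth_death_prob (R : realType) (r l a : int -> R) (n i : int) : R :=
  if i == n + 1 then r n
  else if i == n - 1 then l n
  else if i == n then a n
  else 0.

(* [X] is the chain before killing and [P x] its law when started at [x].
   The Markov property is the elementary one, with the conditioning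
   multiplied out so that nothing is divided by the probability of the past. *)
Definition markov_chain_from (R : realType) (d : measure_display)
    (Omega : measurableType d) (p : int -> int -> R)
    (P : int -> probability Omega R) (X : nat -> Omega -> int) : Prop :=
  [/\ forall m n, measurable [set w | X m w = n],
      forall x, P x [set w | X 0%N w = x] = 1%E
    & forall (x : int) (m : nat) (s : nat -> int),
        P x [set w | forall i, (i <= m.+1)%N -> X i w = s i] =
        (P x [set w | forall i, (i <= m)%N -> X i w = s i]
         * (p (s m) (s m.+1))%:E)%E].

(* [None] in place of [A] or [B] means that this absorbing state is not
   present. *)
Definition absorbing (A B : option int) (n : int) : bool :=
  (A == Some n) || (B == Some n).

Definition admissible (A B : option int) (j k : int) : Prop :=
  match A, B with
  | Some a, Some b => [/\ a < b, a < j < b & a < k < b]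
  | Some c, None | None, Some c => (j < c /\ k < c) \/ (c < j /\ c < k)
  | None, None => True
  end.

(* The infimum of the empty set is [+oo]. *)
Definition absorption_time (R : realType) (Omega : Type) (A B : option int)
    (X : nat -> Omega -> int) (w : Omega) : \bar R :=
  ereal_inf [set (m%:R)%:E | m in [set m : nat | absorbing A B (X m w)]].

(* [None] is the cemetery point. *)
Definition killed (R : realType) (Omega : Type) (A B : option int)
    (X : nat -> Omega -> int) (m : nat) (w : Omega) : option int :=
  if (absorption_time R A B X w <= (m%:R)%:E)%E then None else Some (X m w).

Definition green (R : realType) (d : measure_display)
    (Omega : measurableType d) (A B : option int)
    (P : int -> probability Omega R) (X : nat -> Omega -> int)
    (x y : int) : \bar R :=
  (\int[P x]_w
     \sum_(0 <= m <oo | ((m%:R)%:E <= absorption_time R A B X w)%E)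
        ((killed R A B X m w == Some y)%:R)%:E)%E.

Definition recurrent_state (R : realType) (d : measure_display)
    (Omega : measurableType d) (A B : option int)
    (P : int -> probability Omega R) (X : nat -> Omega -> int)
    (x : int) : Prop :=
  P x [set w | exists2 m : nat, (0 < m)%N & killed R A B X m w = Some x] = 1%E.

(* Recurrence and transience are those of the killed chain, whose states are
   the non-absorbing integers.  If an absorbing state is present then no state
   is recurrent, and otherwise the chain is irreducible; so the states are
   either all recurrent or all transient, and transience of the chain is the
   negation of its recurrence. *)
Definition recurrent_chain (R : realType) (d : measure_display)
    (Omega : measurableType d) (A B : option int)
    (P : int -> probability Omega R) (X : nat -> Omega -> int) : Prop :=
  forall x, ~~ absorbing A B x -> recurrent_state A B P X x.

Definition transient_chain (R : realType) (d : measure_display)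
    (Omega : measurableType d) (A B : option int)
    (P : int -> probability Omega R) (X : nat -> Omega -> int) : Prop :=
  ~ recurrent_chain A B P X.

(* Main.v *)
(* Killing makes [G(x, y)] the sum over [m] of the total weight [u x m y] of
   the non-absorbed paths of length [m] from [x] to [y].  The chain is
   reversible for the measure [pi] with [pi (n+1) / pi n = r n / l (n+1)], that
   is, [pi x * u x m y = pi y * u y m x]; summing over [m] gives
   [pi j * G(j, k) = pi k * G(k, j)], whence the ratio, provided that [G(k, j)]
   is finite.  By the renewal equation for first returns, [G(x, x)] is infinite
   exactly when the return probability of [x] is [1], and finiteness is carried
   between communicating states by [u x m y * u y n z <= u x (m + n) z].  With
   an absorbing state [c], the return probability of [k] is less than [1] since
   the chain may walk straight from [k] to [c]; without one, all states
   communicate. *)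
Require Import Defs.
From mathcomp Require Import all_boot all_order all_algebra.
From mathcomp Require Import all_classical all_reals all_analysis.
From mathcomp Require Import measurable_realfun zify ring lra.
Import Order.TTheory GRing.Theory Num.Theory.
Set Implicit Arguments.
Unset Strict Implicit.
Unset Printing Implicit Defensive.
Local Open Scope classical_set_scope.
Local Open Scope ring_scope.

(** * Weights of lattice paths: reversibility and concatenation *)

Section WalkWeights.
Context (R : realType) (r l a : int -> R).

(** The forward operator of the chain: a mass function [v] is carried to its value at [y] one step
    later, by arrivals from [y - 1], [y] and [y + 1]. *)
Definition step (v : int -> R) (y : int) : R :=
  v (y - 1) * r (y - 1) + v y * a y + v (y + 1) * l (y + 1).

(* [weight Q x m y] is the total weight of the paths of length [m] from [x] to
   [y] whose [i]-th vertex satisfies [Q i] for every [i <= m]. *)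
Fixpoint weight (Q : nat -> int -> bool) (x : int) (m : nat) (y : int) : R :=
  if m is m'.+1 then (if Q m y then step (weight Q x m') y else 0)
  else (Q 0%N y && (y == x))%:R.

Hypothesis hrates : birth_death_rates r l a.

Let r_gt0 n : 0 < r n. Proof. by case: (hrates n). Qed.
Let l_gt0 n : 0 < l n. Proof. by case: (hrates n). Qed.
Let a_ge0 n : 0 <= a n. Proof. by case: (hrates n). Qed.

Lemma step_ge0 v y : (forall z, 0 <= v z) -> 0 <= step v y.
Proof.
by move=> v0; rewrite !addr_ge0// mulr_ge0// ?a_ge0// ltW// ?r_gt0 ?l_gt0.
Qed.

Lemma weight_ge0 Q x m y : 0 <= weight Q x m y.
Proof.
elim: m y => [|m IH] y /=; first exact: ler0n.
by case: ifP => // _; exact: step_ge0.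
Qed.

Lemma ler_step v w y : (forall z, v z <= w z) -> step v y <= step w y.
Proof.
move=> vw; have := @step_ge0 (fun z => w z - v z) y.
have -> : step (fun z => w z - v z) y = step w y - step v y.
  by rewrite /step; ring.
by rewrite subr_ge0; apply=> z; rewrite subr_ge0.
Qed.

Section Killed.
Variable ok : int -> bool.

Notation u := (weight (fun _ => ok)).

Lemma step_unit (b : int -> bool) x y :
  step (fun z => (b z && (z == x))%:R) y =
  (b x)%:R *
  (r x * (x + 1 == y)%:R + a x * (x == y)%:R + l x * (x - 1 == y)%:R).
Proof.
have shift (f : int -> R) (c : int) :
    (b (y + c) && (y + c == x))%:R * f (y + c) =
    (b x)%:R * (f x * (x - c == y)%:R).
  have -> : (y + c == x) = (x - c == y) by rewrite subr_eq eq_sym.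
  case: eqP => [<-|_]; first by rewrite subrK andbT mulr1.
  by rewrite andbF !mulr0 mul0r.
rewrite /step (shift r (-1)) (shift l 1) opprK.
have := shift a 0; rewrite addr0 subr0 => ->.
by rewrite !mulrDr.
Qed.

(** The recursion of [weight] splits off the last step of a path. Splitting off the first step
    instead is possible because the two operations act at opposite ends and commute. *)
Lemma weight_first_step x m y :
  u x m.+1 y = if ok x
    then r x * u (x + 1) m y + a x * u x m y + l x * u (x - 1) m y else 0.
Proof.
elim: m y => [|m IH] y.
  transitivity (if ok y then step (fun z => (ok z && (z == x))%:R) y else 0).
    by [].
  rewrite step_unit /=.
  case: (ok x) => /=; last by rewrite !mul0r if_same.
  rewrite mul1r (eq_sym y (x + 1)) (eq_sym y x) (eq_sym y (x - 1)).
  by case: (ok y) => /=; last by rewrite !mulr0 !addr0.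
have weightS z n w : u z n.+1 w = if ok w then step (u z n) w else 0 by [].
rewrite 4!(weightS _ _ y) {1}/step !IH.
by case: (ok x); case: (ok y); rewrite /step; ring.
Qed.

(** Reading a path backwards: the first step on one side is matched with the last step on the other,
    and detailed balance moves [p] across that edge. *)
Lemma weight_reversible (p : int -> R) :
  (forall n, p n * r n = p (n + 1) * l (n + 1)) ->
  forall m x y, p x * u x m y = p y * u y m x.
Proof.
move=> hp; elim=> [|m IH] x y.
  by rewrite /= eq_sym; have [->|] := eqVneq x y; rewrite ?andbF ?mulr0.
rewrite weight_first_step /=; case: ifP => _; last by rewrite !mulr0.
have h1 : p (x - 1) * r (x - 1) = p x * l x by rewrite hp subrK.
transitivity (p (x - 1) * u (x - 1) m y * r (x - 1) + p x * u x m y * a x +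
    p (x + 1) * u (x + 1) m y * l (x + 1)).
  by rewrite !mulrDr !mulrA -h1 hp; ring.
by rewrite (IH (x - 1)) (IH x) (IH (x + 1)) /step; ring.
Qed.

(** Paths from [x] to [z] that are at [y] at time [m] are only some of all such paths. *)
Lemma weight_chapman x y z m n : u x m y * u y n z <= u x (m + n)%N z.
Proof.
elim: n z => [|n IH] z.
  rewrite addn0 /=; have [->|_] := eqVneq z y; last first.
    by rewrite andbF mulr0 weight_ge0.
  by case: (ok y); rewrite /= ?mulr1// mulr0 weight_ge0.
rewrite addnS /=; case: ifP => _; last by rewrite mulr0.
have -> : u x m y * step (u y n) z = step (fun z => u x m y * u y n z) z.
  by rewrite /step; ring.
exact: ler_step.
Qed.

Lemma weight_up_gt0 x n : (forall i : nat, (i <= n)%N -> ok (x + i%:Z)) ->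
  0 < u x n (x + n%:Z).
Proof.
elim: n => [|n IH] hok /=.
  by have := hok 0%N isT; rewrite addr0 eqxx => ->; rewrite ltr01.
rewrite hok//; apply: lt_le_trans (_ : u x n (x + n%:Z) * r (x + n%:Z) <= _).
  by rewrite mulr_gt0// IH// => i ni; exact/hok/leqW.
have -> : x + n.+1%:Z = x + n%:Z + 1 by lia.
by rewrite /step addrK -addrA lerDl addr_ge0// mulr_ge0// ?weight_ge0// ltW.
Qed.

End Killed.
End WalkWeights.

(** * The reversible measure *)

Definition reversible_weight {R : realType} (r l : int -> R) (n : int) : R :=
  match n with
  | Posz m => \prod_(i < m) (r i%:Z / l (i%:Z + 1))
  | Negz m => \prod_(i < m.+1) (l (- i%:Z) / r (- i%:Z - 1))
  end.

Section ReversibleWeight.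
Context (R : realType) (r l a : int -> R).
Hypothesis hrates : birth_death_rates r l a.

Let r_gt0 n : 0 < r n. Proof. by case: (hrates n). Qed.
Let l_gt0 n : 0 < l n. Proof. by case: (hrates n). Qed.

Lemma reversible_weight_gt0 n : 0 < reversible_weight r l n.
Proof. by case: n => m; apply: prodr_gt0 => i _; rewrite divr_gt0. Qed.

Lemma detailed_balance n :
  reversible_weight r l n * r n = reversible_weight r l (n + 1) * l (n + 1).
Proof.
have r0 m : r m != 0 by exact: lt0r_neq0.
have l0 m : l m != 0 by exact: lt0r_neq0.
(* [Negz m] is [-(m+1)]. The edge from -1 to 0 joins the two branches of the definition and is a
   case of its own. *)
case: n => [m|[|m]].
- have -> : Posz m + 1 = Posz m.+1 by lia.
  have e : m%:Z + 1 = m.+1%:Z by lia.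
  rewrite /= big_ord_recr /= e -mulrA divfK//.
- have -> : Negz 0 + 1 = 0 by lia.
  rewrite /= big_ord1 big_ord0 mul1r oppr0 sub0r.
  have -> : Negz 0 = -1 by lia.
  by rewrite divfK.
- have -> : Negz m.+1 + 1 = Negz m by lia.
  rewrite /reversible_weight (big_ord_recr m.+1) /=.
  have -> : Negz m.+1 = - m.+1%:Z - 1 by lia.
  have -> : Negz m = - m.+1%:Z by lia.
  by rewrite -!mulrA mulVf// mulr1.
Qed.

(** Detailed balance telescopes over the [n] edges from [j] to [j + n]. *)
Lemma reversible_weight_ratio j n :
  reversible_weight r l (j + n%:Z) =
  reversible_weight r l j *
  ((\prod_(i < n) r (j + i%:Z)) / (\prod_(i < n) l (j + 1 + i%:Z))).
Proof.
elim: n => [|n IH]; first by rewrite !big_ord0 addr0 divr1 mulr1.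
have l0 m : l m != 0 by exact: lt0r_neq0.
apply: (mulIf (l0 (j + n.+1%:Z))).
have e : j + n.+1%:Z = j + n%:Z + 1 by lia.
rewrite e -detailed_balance IH !big_ord_recr /=.
have -> : j + n%:Z + 1 = j + 1 + n%:Z by lia.
have d0 : \prod_(i < n) l (j + 1 + i%:Z) != 0.
  by apply/prodf_neq0 => i _.
by field; rewrite d0 l0.
Qed.

End ReversibleWeight.

(** * Nonnegative series and the renewal equation *)

Section Renewal.
Context (R : realType).
Implicit Types u f : nat -> R.

Lemma nneseries_le_EFin f (c : R) : (forall n, 0 <= f n) ->
  (forall N, \sum_(i < N) f i <= c) -> (\sum_(0 <= n <oo) (f n)%:E <= c%:E)%E.
Proof.
move=> f0 fc; apply: lime_le.
  by apply: is_cvg_nneseries => n _ _; rewrite lee_fin.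
by apply: nearW => N; rewrite big_mkord sumEFin lee_fin.
Qed.

Lemma EFin_le_nneseries f (c : R) : (forall n, 0 <= f n) ->
  (\sum_(0 <= n <oo) (f n)%:E <= c%:E)%E -> forall N, \sum_(i < N) f i <= c.
Proof.
move=> f0 fc N; rewrite -lee_fin; apply: le_trans fc.
rewrite -sumEFin -(big_mkord xpredT (fun i => (f i)%:E)).
by apply: nneseries_lim_ge => n _ _; rewrite lee_fin.
Qed.

Lemma nneseries_fin_bound f : (forall n, 0 <= f n) ->
  (\sum_(0 <= n <oo) (f n)%:E < +oo)%E ->
  exists2 c : R, (\sum_(0 <= n <oo) (f n)%:E)%E = c%:E & 0 <= c.
Proof.
move=> f0.
have : (0 <= \sum_(0 <= n <oo) (f n)%:E)%E.
  by apply: nneseries_ge0 => n _ _; rewrite lee_fin.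
by case: (\sum_(0 <= n <oo) _)%E => // c c0 _; exists c; rewrite -?lee_fin.
Qed.

(** Carries finiteness of Green's functions between pairs of states: [h] is the length and [c] the
    weight of the connecting paths. *)
Lemma nneseries_shift_lt_pinfty (v w : nat -> R) c h :
  (forall n, 0 <= v n) -> (forall n, 0 <= w n) -> 0 < c ->
  (forall n, c * w n <= v (n + h)%N) ->
  (\sum_(0 <= n <oo) (v n)%:E < +oo -> \sum_(0 <= n <oo) (w n)%:E < +oo)%E.
Proof.
move=> v0 w0 c0 cwv /(nneseries_fin_bound v0)[b vb _].
apply: (@le_lt_trans _ _ (b / c)%:E); last exact: ltry.
apply: nneseries_le_EFin => // N; rewrite ler_pdivlMr// mulrC mulr_sumr.
apply: (@le_trans _ _ (\sum_(i < h + N) v i)); last first.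
  by apply: EFin_le_nneseries; rewrite ?vb.
rewrite big_split_ord /= ler_wpDl ?sumr_ge0//.
by apply: ler_sum => i _; rewrite addnC; exact: cwv.
Qed.

Context (u f : nat -> R).
Hypotheses (u_ge0 : forall n, 0 <= u n) (f_ge0 : forall n, 0 <= f n).
Hypotheses (u0 : u 0%N = 1)
  (renewal : forall n, u n.+1 = \sum_(i < n.+1) f i * u (n - i)%N).

Let S N := \sum_(i < N) u i.

Let S_nondecreasing M N : (M <= N)%N -> S M <= S N.
Proof.
move=> /subnK <-; elim: (N - M)%N => // n IH.
by rewrite /S addSn big_ord_recr /=; apply: ler_wpDr.
Qed.

Let S_ge0 N : 0 <= S N. Proof. exact: sumr_ge0. Qed.

Let S0 : S 0%N = 0. Proof. exact: big_ord0. Qed.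

(** The renewal equation summed over time. The index of [f] is shifted: [f i] plays the part of a
    first return at time [i + 1]. *)
Let renewal_sum N : S N.+1 = 1 + \sum_(i < N) f i * S (N - i)%N.
Proof.
rewrite {1}/S big_ord_recl u0; congr (1 + _).
elim: N => [|N IH]; first by rewrite !big_ord0.
rewrite big_ord_recr /= IH /bump leq0n add1n renewal.
transitivity (\sum_(i < N.+1) (f i * S (N - i)%N + f i * u (N - i)%N)).
  by rewrite [RHS]big_split /= [in RHS]big_ord_recr /= subnn S0 mulr0 addr0.
apply: eq_bigr => i _; have iN : (i <= N)%N by rewrite -ltnS.
by rewrite subSn// /S big_ord_recr /= mulrDr.
Qed.

(** With [c] the sum of [f], monotonicity gives [S N <= S N.+1 <= 1 + c * S N], so [S N] is at most
    [1 / (1 - c)]. *)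
Lemma renewal_transient :
  (\sum_(0 <= n <oo) (f n)%:E < 1 -> \sum_(0 <= n <oo) (u n)%:E < +oo)%E.
Proof.
move=> F1; have [|c Fc c0] := nneseries_fin_bound f_ge0.
  by apply: lt_trans F1 _; exact: ltry.
rewrite Fc lte_fin in F1.
apply: (@le_lt_trans _ _ ((1 - c)^-1)%:E); last exact: ltry.
apply: nneseries_le_EFin => // N; rewrite -/(S N).
have c1 : 0 < 1 - c by rewrite subr_gt0.
rewrite -[leRHS]mul1r ler_pdivlMr// mulrBr mulr1 lerBlDr mulrC.
apply: le_trans (S_nondecreasing (leqnSn N)) _.
rewrite renewal_sum lerD2l.
apply: (@le_trans _ _ (\sum_(i < N) f i * S N)).
  apply: ler_sum => i _; apply: ler_wpM2l => //.
  exact/S_nondecreasing/leq_subr.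
rewrite -mulr_suml ler_wpM2r//.
by apply: EFin_le_nneseries; rewrite ?Fc.
Qed.

(** If [u] had a finite sum [s], every partial sum would be at most [s - 1], whence [s <= s - 1]. *)
Lemma renewal_recurrent :
  (\sum_(0 <= n <oo) (f n)%:E = 1 -> \sum_(0 <= n <oo) (u n)%:E = +oo)%E.
Proof.
move=> F1; apply/eqP; rewrite eq_le leey leNgt; apply/negP => Uoo.
have [s Us s0] := nneseries_fin_bound u_ge0 Uoo.
have Ss : forall N, S N <= s by apply: EFin_le_nneseries; rewrite ?Us.
suff : (s%:E <= (s - 1)%:E)%E by rewrite lee_fin; lra.
rewrite -[leLHS]Us; apply: nneseries_le_EFin => // M; rewrite -/(S M).
case: M => [|M].
  by rewrite /S big_ord0 subr_ge0; move: (Ss 1%N); rewrite /S big_ord1 u0.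
have SM : 0 < S M.+1.
  by rewrite /S big_ord_recl u0; apply: ltr_wpDr; rewrite ?sumr_ge0.
(* The factor 1 is replaced by the series of [f], so it is enough to bound its partial sums times
   [S M.+1]. *)
rewrite -[leLHS]mul1r -ler_pdivlMr// -lee_fin -[leLHS]F1.
apply: nneseries_le_EFin => // N; rewrite ler_pdivlMr// lerBrDl.
(* At this time the first [N] terms of the renewal sum all carry a factor that is at least
   [S M.+1]. *)
apply: le_trans _ (Ss (N + M.+1).+1).
rewrite (renewal_sum (N + M.+1)) lerD2l.
rewrite big_split_ord /= mulr_suml ler_wpDr//.
  by apply: sumr_ge0 => i _; rewrite mulr_ge0.
apply: ler_sum => i _; apply: ler_wpM2l => //; apply: S_nondecreasing.
by have := ltn_ord i; lia.
Qed.

End Renewal.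

(** * Decomposition of path weights at the first return *)

Section FirstReturn.
Context (R : realType) (r l a : int -> R) (ok : int -> bool).
Hypothesis hrates : birth_death_rates r l a.

(** Time 0 is exempt because the path starts at [x] itself. *)
Definition avoiding (x : int) (i : nat) (y : int) : bool :=
  ok y && ((i == 0%N) || (y != x)).

(** The return happens at time [n + 1]: [n] steps that avoid [x], then one step onto it. *)
Definition first_return (x : int) (n : nat) : R :=
  if ok x then step r l a (weight r l a (avoiding x) x n) x else 0.

Notation u := (weight r l a (fun _ => ok)).
Notation g x := (weight r l a (avoiding x) x).

Lemma first_return_ge0 x n : 0 <= first_return x n.
Proof.
rewrite /first_return; case: ifP => // _.
by apply: step_ge0 => // z; exact: weight_ge0.
Qed.

(** Either the path has not come back to [x] by time [n], or it first does so at some time [i + 1]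
    and runs freely for the remaining [n - 1 - i] steps. *)
Lemma weight_first_return x n y :
  u x n y = g x n y + \sum_(i < n) first_return x i * u x (n.-1 - i)%N y.
Proof.
elim: n y => [|n IH] y; first by rewrite big_ord0 addr0 /= /avoiding eqxx andbT.
(* One more step of a path that has not yet returned either stays off [x] or is the first return,
   after which no time remains. *)
have avoid : (if ok y then step r l a (g x n) y else 0) =
    g x n.+1 y + first_return x n * u x 0 y.
  rewrite /first_return /= /avoiding /=; have [->|_] := eqVneq y x.
    by rewrite andbF andbT add0r; case: (ok x); rewrite ?mulr1 ?mulr0.
  by rewrite !(andbT, andbF) mulr0 addr0.
have subn_succ (i : 'I_n) : (n - i)%N = (n.-1 - i).+1.
  by have := ltn_ord i; lia.
rewrite big_ord_recr /= subnn addrA addrAC -[X in _ = X + _]avoid.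
have [oky|nok] := boolP (ok y); last first.
  rewrite add0r big1// => i _.
  by rewrite /= subn_succ /= (negbTE nok) mulr0.
have stepD v w : step r l a (fun z => v z + w z) y =
    step r l a v y + step r l a w y by rewrite /step; ring.
have step_sum I s (F : I -> int -> R) :
    step r l a (fun z => \sum_(i <- s) F i z) y =
    \sum_(i <- s) step r l a (F i) y.
  elim: s => [|i s IHs].
    by rewrite big_nil /step !big_nil !mul0r !addr0.
  rewrite big_cons -IHs -stepD; rewrite /step.
  by rewrite !big_cons.
transitivity (step r l a
    (fun z => g x n z + \sum_(i < n) first_return x i * u x (n.-1 - i)%N z) y).
  by rewrite /step !IH.
rewrite stepD step_sum; congr (_ + _); apply: eq_bigr => i _.
by rewrite subn_succ /= oky /step; ring.
Qed.

Lemma weight_renewal x n : u x n.+1 x =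
  \sum_(i < n.+1) first_return x i * u x (n - i)%N x.
Proof. by rewrite weight_first_return /= /avoiding eqxx andbF add0r. Qed.

Lemma first_return_transient x : ok x ->
  (\sum_(0 <= n <oo) (first_return x n)%:E < 1 ->
   \sum_(0 <= n <oo) (u x n x)%:E < +oo)%E.
Proof.
move=> okx; apply: renewal_transient.
- by move=> n; exact: weight_ge0.
- by move=> n; exact: first_return_ge0.
- by rewrite /= okx eqxx.
- exact: weight_renewal.
Qed.

Lemma first_return_recurrent x : ok x ->
  (\sum_(0 <= n <oo) (first_return x n)%:E = 1 ->
   \sum_(0 <= n <oo) (u x n x)%:E = +oo)%E.
Proof.
move=> okx; apply: renewal_recurrent.
- by move=> n; exact: weight_ge0.
- by move=> n; exact: first_return_ge0.
- by rewrite /= okx eqxx.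
- exact: weight_renewal.
Qed.

End FirstReturn.

(** * The Markov property for events of the past *)

Section MarkovPast.
Context (R : realType) (d : measure_display) (Omega : measurableType d).
Context (p : int -> int -> R) (P : int -> probability Omega R).
Context (X : nat -> Omega -> int).
Hypothesis hX : markov_chain_from p P X.

(** Histories form a countable type, so an event of the past is a countable disjoint union of
    cylinders. *)
Definition past (m : nat) (w : Omega) : seq int := mkseq (X^~ w) m.+1.

Lemma nth_past m w i : (i <= m)%N -> nth 0 (past m w) i = X i w.
Proof. by move=> im; rewrite nth_mkseq. Qed.

Lemma last_past m w : last 0 (past m w) = X m w.
Proof. by rewrite -nth_last size_mkseq nth_past. Qed.

Lemma eq_past m w w' :
  (past m w = past m w') <-> (forall i, (i <= m)%N -> X i w = X i w').
Proof.
split=> [e i im|e]; first by rewrite -!(nth_past _ im) e.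
apply: (@eq_from_nth _ 0); rewrite !size_mkseq// => i im.
by rewrite !nth_past// e.
Qed.

Lemma measurable_cylinder m (s : nat -> int) :
  measurable [set w | forall i, (i <= m)%N -> X i w = s i].
Proof.
rewrite (_ : mkset _ =
    \bigcap_(i in [set i | (i <= m)%N]) [set w | X i w = s i]).
  apply: bigcap_measurable; first by exists 0%N.
  by move=> i _; case: hX => + _ _; exact.
by apply/seteqP; split=> w /=.
Qed.

(** The histories are enumerated by [pickle]; for an event of the past, each piece is empty or a
    single cylinder. *)
Let piece (S : set Omega) m n := S `&` [set w | pickle (past m w) = n].

Let bigcup_piece S m : S = \bigcup_n piece S m n.
Proof.
apply/seteqP; split=> [w Sw|w [n _ []]//].
by exists (pickle (past m w)).
Qed.

Let trivIset_piece S m : trivIset setT (piece S m).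
Proof. by move=> n n' _ _ [w [[_ /= <-] [_ /= <-]]]. Qed.

Let piece_past m (Q : set (seq int)) n w0 :
  piece [set w | Q (past m w)] m n w0 ->
  piece [set w | Q (past m w)] m n =
  [set w | forall i, (i <= m)%N -> X i w = X i w0].
Proof.
move=> [/= Qw0 <-]; apply/seteqP; split=> w /=.
  by move=> [_ /(pcan_inj pickleK)/eq_past].
by move=> /eq_past e; split; rewrite /= e.
Qed.

Let measurable_piece m (Q : set (seq int)) n :
  measurable (piece [set w | Q (past m w)] m n).
Proof.
have [->|/set0P[w0 /piece_past ->]] :=
    eqVneq (piece [set w | Q (past m w)] m n) set0.
  exact: measurable0.
exact: measurable_cylinder.
Qed.

Lemma measurable_past m (Q : set (seq int)) : measurable [set w | Q (past m w)].
Proof.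
by rewrite [X in measurable X](bigcup_piece _ m); exact: bigcup_measurable.
Qed.

Lemma measurable_past_next m (Q : set (seq int)) y :
  measurable [set w | Q (past m w) /\ X m.+1 w = y].
Proof.
by apply: measurableI; [exact: measurable_past|case: hX => + _ _; exact].
Qed.

(** The property for single histories is summed over those in [Q]; the factor comes out because all
    of them have the same chance [c] of moving to [y]. *)
Lemma markov_past x m (Q : set (seq int)) y c :
  (forall t, Q t -> p (last 0 t) y = c) ->
  P x [set w | Q (past m w) /\ X m.+1 w = y] =
  (P x [set w | Q (past m w)] * c%:E)%E.
Proof.
move=> Qc; set S := [set w | _]; set T := [set w | Q _].
have ST n : piece S m n = piece T m n `&` [set w | X m.+1 w = y].
  by apply/seteqP; split=> w /=; rewrite /piece /S /T /=; tauto.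
have mS n : measurable (piece S m n).
  rewrite ST; apply: measurableI; first exact: measurable_piece.
  by case: hX => + _ _; exact.
have mT n : measurable (piece T m n) by exact: measurable_piece.
rewrite (bigcup_piece S m) (bigcup_piece T m).
rewrite !measure_semi_bigcup//; try by exact: bigcup_measurable.
rewrite muleC -nneseriesZl//; apply: eq_eseriesr => n _.
rewrite ST; have [->|/set0P[w0 Tw0]] := eqVneq (piece T m n) set0.
  by rewrite set0I !measure0 mule0.
have -> : c = p (X m w0) y.
  by case: Tw0 => /Qc <- _; rewrite last_past.
rewrite (piece_past Tw0) muleC.
pose s i := if (i <= m)%N then X i w0 else y.
case: hX => _ _ /(_ x m s); rewrite {3 4}/s leqnn ltnn => hs.
transitivity (P x [set w | forall i, (i <= m.+1)%N -> X i w = s i]).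
  congr (P x _); apply/seteqP; split=> w /=.
    move=> [ws wy] i; rewrite /s leq_eqVlt ltnS.
    by case: ifP => [/ws//|/negbT im]; rewrite orbF => /eqP ->.
  move=> ws; split=> [i im|]; first by rewrite ws ?leqW// /s im.
  by rewrite ws// /s ltnn.
rewrite hs; congr (P x _ * _)%E; apply/seteqP; split=> w /= ws i im.
  by rewrite ws// /s im.
by rewrite ws// /s im.
Qed.

Lemma path_prob_gt0 (s : nat -> int) m :
  (forall i, 0 < p (s i) (s i.+1)) ->
  (0 < P (s 0%N) [set w | forall i, (i <= m)%N -> X i w = s i])%E.
Proof.
move=> ps; case: hX => _ h0 hS; elim: m => [|m IH].
  rewrite (_ : mkset _ = [set w | X 0%N w = s 0%N]) ?h0//.
  by apply/seteqP; split=> w /= h => [|[|i]//]; exact: h.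
by rewrite hS mule_gt0// lte_fin.
Qed.

End MarkovPast.

(** * Path weights as probabilities *)

Section BirthDeathPast.
Context (R : realType) (d : measure_display) (Omega : measurableType d).
Context (r l a : int -> R) (P : int -> probability Omega R).
Context (X : nat -> Omega -> int).
Hypothesis hX : markov_chain_from (birth_death_prob r l a) P X.

Notation p := (birth_death_prob r l a).

Lemma birth_death_prob_up n : p n (n + 1) = r n.
Proof. by rewrite /birth_death_prob eqxx. Qed.

Lemma birth_death_prob_down n : p n (n - 1) = l n.
Proof.
rewrite /birth_death_prob eqxx ifF//; apply/negbTE; lia.
Qed.

Lemma birth_death_prob_stay n : p n n = a n.
Proof.
by rewrite /birth_death_prob eqxx !ifF//; apply/negbTE; lia.
Qed.

Lemma birth_death_prob_far n i :
  n != i - 1 -> n != i -> n != i + 1 -> p n i = 0.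
Proof. by move=> *; rewrite /birth_death_prob !ifF//; apply/negbTE; lia. Qed.

Definition staying (Q : nat -> int -> bool) (m : nat) (y : int) : set Omega :=
  [set w | (forall i, (i <= m)%N -> Q i (X i w)) /\ X m w = y].

Lemma stayingE Q m y : staying Q m y = [set w |
  [set t | (forall i, (i <= m)%N -> Q i (nth 0 t i)) /\ last 0 t = y]
    (past X m w)].
Proof.
apply/seteqP; split=> w [Qw <-]; split; rewrite ?last_past// => i im.
  by rewrite nth_past// Qw.
by rewrite -(nth_past X w im) Qw.
Qed.

Lemma measurable_staying Q m y : measurable (staying Q m y).
Proof. by rewrite stayingE; exact: (measurable_past hX). Qed.

Lemma staying_next_past (Q : nat -> int -> bool) m y :
  [set w | (forall i, (i <= m)%N -> Q i (X i w)) /\ X m.+1 w = y] =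
  [set w | [set t | forall i, (i <= m)%N -> Q i (nth 0 t i)] (past X m w) /\
           X m.+1 w = y].
Proof.
apply/seteqP; split=> w [Qw <-]; split=> // i im.
  by rewrite nth_past//; exact: Qw.
by rewrite -(nth_past X w im); exact: Qw.
Qed.

Lemma measurable_staying_next (Q : nat -> int -> bool) m y :
  measurable [set w | (forall i, (i <= m)%N -> Q i (X i w)) /\ X m.+1 w = y].
Proof. by rewrite staying_next_past; exact: (measurable_past_next hX). Qed.

(** The cases are the position at time [m]. Leaving time [m + 1] free of [Q] makes the formula apply
    to a first return, which lands on the very vertex that was avoided. *)
Lemma prob_staying_next Q x m y :
  (forall z, P x (staying Q m z) = (weight r l a Q x m z)%:E) ->
  P x [set w | (forall i, (i <= m)%N -> Q i (X i w)) /\ X m.+1 w = y] =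
  (step r l a (weight r l a Q x m) y)%:E.
Proof.
move=> IH; rewrite staying_next_past.
set W := [set t | _] : set (seq int).
have split_last (V : set (seq int)) (z : int) :
    P x [set w | V (past X m w) /\ X m.+1 w = y] =
    (P x [set w | [set t | V t /\ last 0%R t <> z] (past X m w) /\
                  X m.+1 w = y] +
     P x [set w | [set t | V t /\ last 0%R t = z] (past X m w) /\
                  X m.+1 w = y])%E.
  rewrite (measureDI (P x) (measurable_past_next hX m V y)
    (measurable_past hX m [set t | last 0 t = z])).
  by congr (P x _ + P x _)%E; apply/seteqP; split=> w /=; tauto.
have known (V : set (seq int)) (z : int) :
    (forall t, V t -> W t /\ last 0 t = z) ->
    (forall t, W t -> last 0 t = z -> V t) ->
    P x [set w | V (past X m w) /\ X m.+1 w = y] =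
    (weight r l a Q x m z * p z y)%:E.
  move=> VW WV; rewrite (@markov_past _ _ _ _ _ _ hX x m V y (p z y));
    last by move=> t /VW[_ <-].
  rewrite EFinM -IH stayingE; congr (P x _ * _)%E.
  by apply/seteqP; split=> w; [exact: VW|case=> /WV; exact].
rewrite (split_last _ (y - 1)) (split_last _ y) (split_last _ (y + 1)).
(* What remains after the three splittings are histories that end too far from [y], with transition
   probability 0. *)
rewrite (@markov_past _ _ _ _ _ _ hX _ _ _ _ 0); last first.
  move=> t /= [[[_ /eqP h1] /eqP h2] /eqP h3].
  by rewrite birth_death_prob_far.
rewrite mule0 add0e (known _ (y + 1)); last 2 first.
- by move=> t [[[]]].
- by move=> t Wt e; split=> //; split; [split=> //|]; rewrite e; lia.
rewrite (known _ y); last 2 first.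
- by move=> t [[]].
- by move=> t Wt e; split=> //; split=> //; rewrite e; lia.
rewrite (known _ (y - 1)) //.
have -> : p (y - 1) y = r (y - 1)
  by rewrite -{2}(subrK 1 y) birth_death_prob_up.
have -> : p (y + 1) y = l (y + 1)
  by rewrite -{2}(addrK 1 y) birth_death_prob_down.
by rewrite birth_death_prob_stay -!EFinD /step; congr (_%:E); ring.
Qed.

Lemma prob_staying Q x m y :
  P x (staying Q m y) = (weight r l a Q x m y)%:E.
Proof.
elim: m y => [|m IH] y /=.
  case: hX => mX0 X0 _; have [->|yx] := eqVneq y x.
    have [Qx|nQx] := boolP (Q 0%N x).
      rewrite -(X0 x); congr (P x _); apply/seteqP; split=> w /=; first by case.
      by move=> Xw; split=> // i; rewrite leqn0 => /eqP ->; rewrite Xw.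
    rewrite (_ : staying _ _ _ = set0) ?measure0//; apply/seteqP; split=> w //=.
    by move=> [/(_ 0%N isT) + Xw]; rewrite Xw (negbTE nQx).
  (* The chain starts at [x] only almost surely, so another starting point gives a null event, not
     an empty one. *)
  rewrite andbF; apply/eqP; rewrite eq_le measure_ge0 andbT.
  have -> : 0%:E = P x (~` [set w | X 0%N w = x]).
    by rewrite probability_setC// X0 subee.
  apply: le_measure; rewrite ?inE; [exact: measurable_staying| |].
    exact: measurableC.
  by move=> w [_ /= ->]; apply/eqP.
have [Qy|nQy] := boolP (Q m.+1 y).
  rewrite -prob_staying_next//; congr (P x _).
  apply/seteqP; split=> w [/= Qw Xw].
    by split=> // i im; exact/Qw/leqW.
  by split=> // i; rewrite leq_eqVlt => /predU1P[->|/Qw//]; rewrite Xw.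
rewrite (_ : staying _ _ _ = set0) ?measure0//; apply/seteqP; split=> w //=.
by move=> [/(_ m.+1 (leqnn _)) + Xw]; rewrite Xw (negbTE nQy).
Qed.

End BirthDeathPast.

(** * Green's function and return probability of the killed chain *)

Section KilledChain.
Context (R : realType) (d : measure_display) (Omega : measurableType d).
Context (r l a : int -> R) (A B : option int) (P : int -> probability Omega R).
Context (X : nat -> Omega -> int).

Let ok n := ~~ absorbing A B n.
Notation u := (weight r l a (fun _ => ok)).

Lemma killed_Some m y w : (killed R A B X m w = Some y) <->
  (forall i, (i <= m)%N -> ok (X i w)) /\ X m w = y.
Proof.
rewrite /killed; case: ifPn => hm; split=> //.
- move=> [okX _]; exfalso; move: hm; apply/negP; rewrite -ltNge.
  (* Absorption times are integers, so no absorption up to [m] puts the infimum at [m + 1] or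
     later. *)
  apply: (@lt_le_trans _ _ (m.+1%:R)%:E); first by rewrite lte_fin ltr_nat.
  apply: le_ereal_inf_tmp => _ [n /= absn <-]; rewrite lee_fin ler_nat ltnNge.
  by apply/negP => /okX; rewrite /ok absn.
- move=> [<-]; split=> // i im; apply/negP => absi; move/negP: hm; apply.
  apply: (@le_trans _ _ (i%:R)%:E); last by rewrite lee_fin ler_nat.
  by apply: ereal_inf_lbound; exists i.
- by move=> [_ ->].
Qed.

Hypothesis hrates : birth_death_rates r l a.
Hypothesis hX : markov_chain_from (birth_death_prob r l a) P X.

Lemma green_weight x y : green A B P X x y = (\sum_(0 <= m <oo) (u x m y)%:E)%E.
Proof.
rewrite /green.
transitivity (\int[P x]_w (\sum_(0 <= m <oo)
    (\1_(staying X (fun _ => ok) m y) w)%:E))%E.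
  apply: eq_integral => w _; rewrite eseries_mkcond; apply: eq_eseriesr => m _.
  rewrite indicE.
  have -> : (w \in staying X (fun _ => ok) m y) =
      (killed R A B X m w == Some y).
    by apply/idP/eqP => [|h]; rewrite ?inE; [move=> h|]; exact/killed_Some.
  (* The terms cut off by the bound on [m] vanish anyway: past the absorption time the chain is in
     the cemetery. *)
  case: ifPn => // hm; rewrite /killed ifT//.
  by rewrite -ltNge in hm; exact: ltW.
rewrite integral_nneseries//=; last first.
  by move=> m; apply/measurable_EFinP/measurable_indic;
    exact: (measurable_staying hX).
apply: eq_eseriesr => m _; rewrite integral_indic//.
  by rewrite setIT; exact: (prob_staying hX).
exact: (measurable_staying hX).
Qed.

Definition return_event (x : int) : set Omega :=
  [set w | exists2 m, (0 < m)%N & killed R A B X m w = Some x].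

(** The condition [ok x] keeps the chain alive at time [n + 1], a time that [avoiding] does not test
    here. *)
Let first_return_event x n : set Omega :=
  [set w | ok x /\ (forall i, (i <= n)%N -> avoiding ok x i (X i w)) /\
           X n.+1 w = x].

Let return_eventE x : return_event x = \bigcup_n first_return_event x n.
Proof.
apply/seteqP; split=> w /=; last first.
  move=> [n _ [okx [hn Xn]]]; exists n.+1 => //; apply/killed_Some; split=> //.
  by move=> i; rewrite leq_eqVlt => /predU1P[->|/hn/andP[]//]; rewrite Xn.
move=> ex; have {}ex : exists m, (0 < m)%N && (killed R A B X m w == Some x).
  by case: ex => m m0 h; exists m; rewrite m0 h eqxx.
(* The least return time is the first return. *)
case: (ex_minnP ex) => -[//|m] /andP[_ /eqP/killed_Some[okX Xm]] mmin.
exists m => //; split; first by rewrite -Xm; exact: okX.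
split=> // i im; rewrite /avoiding okX ?leqW//=.
case: i im => //= i im; apply/eqP => Xi.
suff /mmin : (0 < i.+1)%N && (killed R A B X i.+1 w == Some x).
  by rewrite ltnNge im.
apply/eqP/killed_Some; split=> // n ni; apply: okX.
exact: leq_trans ni (leqW im).
Qed.

Let measurable_first_return_event x n : measurable (first_return_event x n).
Proof.
rewrite /first_return_event; case: (ok x).
  have := measurable_staying_next hX (avoiding ok x) n x.
  by congr measurable; apply/seteqP; split=> w; [split|case].
by rewrite (_ : mkset _ = set0)//; apply/seteqP; split=> w //= [].
Qed.

Lemma measurable_return_event x : measurable (return_event x).
Proof. by rewrite return_eventE; exact: bigcup_measurable. Qed.

Lemma prob_return x :
  P x (return_event x) = (\sum_(0 <= n <oo) (first_return r l a ok x n)%:E)%E.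
Proof.
rewrite return_eventE measure_semi_bigcup//; last 2 first.
- apply: ltn_trivIset => n m nm; rewrite -subset0 => w /=.
  move=> [[_ [_ Xm]] [_ [hn _]]].
  by have := hn _ nm; rewrite /avoiding Xm eqxx andbF.
- exact: bigcup_measurable.
apply: eq_eseriesr => n _; rewrite /first_return /first_return_event.
case: (ok x).
  rewrite -(prob_staying_next hX); last by move=> z; exact: prob_staying.
  by congr (P x _); apply/seteqP; split=> w; [case|split].
by rewrite (_ : mkset _ = set0) ?measure0//; apply/seteqP; split=> w //= [].
Qed.

(* The walk that heads straight for the absorbing state is killed there before
   it can return. *)
Lemma absorbing_return_lt1 c x : absorbing A B c -> ok x ->
  (P x (return_event x) < 1)%E.
Proof.
move=> absc okx; have cx : c != x by apply: contraNneq okx => <-.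
pose e : int := if x < c then 1 else -1.
pose s i := x + e * i%:Z.
have sc : s `|c - x|%N = c by rewrite /s /e; case: ltP; lia.
have sx i : s i.+1 != x by rewrite /s /e; case: ltP; lia.
have s_step i : 0 < birth_death_prob r l a (s i) (s i.+1).
  case: (hrates (s i)) => r0 l0 _ _.
  have [e1|e1] : e = 1 \/ e = -1 by rewrite /e; case: ifP; [left|right].
    have -> : s i.+1 = s i + 1 by rewrite /s e1; lia.
    by rewrite birth_death_prob_up.
  have -> : s i.+1 = s i - 1 by rewrite /s e1; lia.
  by rewrite birth_death_prob_down.
have s0 : s 0%N = x by rewrite /s mulr0 addr0.
have := path_prob_gt0 hX `|c - x|%N s_step; rewrite s0.
set C := [set w | _]; have mC : measurable C by exact: (measurable_cylinder hX).
move=> PC; apply: (@le_lt_trans _ _ (P x (~` C))).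
  apply: le_measure; rewrite ?inE;
    [exact: measurable_return_event|exact: measurableC|].
  move=> w [[//|m] _ /killed_Some[okX Xm]] Cw.
  (* A return from time [|c - x|] on would come after the visit to [c]; before that, the path is
     never at [x] at a positive time. *)
  have [cm|mc] := leqP `|c - x|%N m.+1.
    by have := okX _ cm; rewrite Cw// sc /ok absc.
  by move/eqP: Xm; rewrite Cw ?(ltnW mc)// (negbTE (sx m)).
rewrite probability_setC//.
have PC1 := probability_le1 (P x) mC.
move: PC PC1; case: (P x C) => // q; rewrite lte_fin => q0 _.
by rewrite -EFinB lte_fin ltrBlDr ltrDl.
Qed.

(** The straight upward path has positive weight, and reversibility passes this on to the downward
    one. *)
Lemma weight_connected (x y : int) :
  (forall n, Num.min x y <= n <= Num.max x y -> ok n) ->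
  exists s, 0 < u x s y.
Proof.
have up (z : int) n : (forall i, (i <= n)%N -> ok (z + i%:Z)) ->
    0 < u z n (z + n%:Z) /\ 0 < u (z + n%:Z) n z.
  move=> okz; have h := weight_up_gt0 hrates okz; split=> //.
  have := weight_reversible a ok (detailed_balance hrates) n z (z + n%:Z).
  move=> e.
  rewrite -(pmulr_rgt0 _ (reversible_weight_gt0 hrates (z + n%:Z))) -e.
  by rewrite mulr_gt0// (reversible_weight_gt0 hrates).
move=> okxy; exists `|y - x|%N; have [xy|yx] := lerP x y.
  have e : y = x + `|y - x|%N%:Z by lia.
  rewrite {2}e; apply: (proj1 (up _ _ _)) => i ixy.
  by apply: okxy; rewrite min_l// max_r//; lia.
have e : x = y + `|y - x|%N%:Z by lia.
rewrite {1}e; apply: (proj2 (up _ _ _)) => i ixy.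
by have xy := ltW yx; apply: okxy; rewrite min_r// max_l//; lia.
Qed.

End KilledChain.

(** * The dichotomy and the ratio formula *)

Lemma admissible_not_absorbing A B j k n :
  admissible A B j k -> j < k -> j <= n <= k -> ~~ absorbing A B n.
Proof.
rewrite /admissible /absorbing negb_or => hadm jk /andP[jn nk].
case: A B hadm => [x|] [y|] //= h; rewrite ?andbT; try apply/andP; try split;
  apply/eqP => -[] e; subst; move: h;
  first [case=> ? /andP[? ?] /andP[? ?]|case=> -[]|idtac]; lia.
Qed.

Theorem theorem1 (R : realType) (d : measure_display)
    (Omega : measurableType d) (r l a : int -> R) (A B : option int)
    (P : int -> probability Omega R) (X : nat -> Omega -> int) (j k : int)
    (hrates : birth_death_rates r l a)
    (hX : markov_chain_from (birth_death_prob r l a) P X)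
    (hadm : admissible A B j k) (hjk : j < k) :
  (recurrent_chain A B P X ->
     green A B P X j k = +oo%E /\ green A B P X k j = +oo%E) /\
  (transient_chain A B P X ->
     (green A B P X j k / green A B P X k j)%E =
     ((\prod_(i < `|k - j|%N) r (j + i%:Z)) /
      (\prod_(i < `|k - j|%N) l (j + 1 + i%:Z)))%:E).
Proof.
rewrite !(green_weight _ _ hX).
pose ok n := ~~ absorbing A B n; pose u := weight r l a (fun _ => ok).
rewrite -/ok -/u.
have okjk n : j <= n <= k -> ok n by exact: admissible_not_absorbing hadm hjk.
have okj : ok j by apply: okjk; lia.
have okk : ok k by apply: okjk; lia.
have u0 x m y : 0 <= u x m y by exact: weight_ge0.
have [h jk_gt0] : exists h, 0 < u j h k.
  by apply: (weight_connected hrates) => n;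
    rewrite min_l ?max_r ?(ltW hjk)//; exact: okjk.
have [h' kj_gt0] : exists h, 0 < u k h j.
  by apply: (weight_connected hrates) => n;
    rewrite min_r ?max_l ?(ltW hjk)//; exact: okjk.
split.
  move=> hrec.
  have visits x : ok x -> (\sum_(0 <= n <oo) (u x n x)%:E = +oo)%E.
    move=> okx; apply: (first_return_recurrent hrates) => //.
    by rewrite -(prob_return _ _ hX); exact: hrec.
  (* Each loop at [x] followed by a path of length [s] to [y] is a path to [y], so a finite sum at
     [y] would make the sum at [x] finite. *)
  have infinite x y s : ok x -> 0 < u x s y ->
      (\sum_(0 <= n <oo) (u x n y)%:E = +oo)%E.
    move=> okx xy; apply/eqP; rewrite eq_le leey leNgt; apply/negP => fin.
    have := visits x okx; apply/eqP; rewrite lt_eqF//.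
    apply: (nneseries_shift_lt_pinfty _ _ xy (h := s)) fin => // n.
    by rewrite mulrC; exact: weight_chapman.
  by split; [exact: infinite jk_gt0|exact: infinite kj_gt0].
move=> htrans.
(* A state of return probability below 1 that is reached from [j] and leads to [k]: [k] itself if an
   absorbing state is present, otherwise any state that is not recurrent. *)
have [x [okx ret_lt1 [s xk_gt0] [t jx_gt0]]] : exists x, [/\ ok x,
    (P x (return_event R A B X x) < 1)%E,
    exists s, 0 < u x s k & exists t, 0 < u j t x].
  have [[c absc]|noabs] := pselect (exists c, absorbing A B c).
    exists k; split=> //.
    - exact: (absorbing_return_lt1 hrates hX absc).
    - by exists 0%N; rewrite /u /= okk eqxx.
    - by exists h.
  have okT n : ok n by apply/negP => absn; apply: noabs; exists n.
  have /existsNP[x /not_implyP[okx nrec]] := htrans.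
  exists x; split=> //;
    [|by apply: (weight_connected hrates) => n _; exact: okT..].
  rewrite lt_neqAle probability_le1 ?andbT; first by apply/eqP => /nrec.
  exact: (measurable_return_event _ _ hX).
have kj_fin : (\sum_(0 <= n <oo) (u k n j)%:E < +oo)%E.
  (* A path from [k] to [j] is completed to a loop at [x], by [s] steps from [x] to [k] before it
     and [t] steps from [j] to [x] after it. *)
  apply: (nneseries_shift_lt_pinfty (v := fun n => u x n x)
    (c := u x s k * u j t x) (h := (s + t)%N)) => //.
  - by rewrite mulr_gt0.
  - move=> n; rewrite addnCA addnA mulrAC.
    apply: le_trans (weight_chapman hrates _ _ j _ _ _).
    by apply: ler_wpM2r => //; exact: weight_chapman.
  - apply: (first_return_transient hrates) => //.
    by rewrite -(prob_return _ _ hX).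
have [b kjE b_ge0] := nneseries_fin_bound (fun n => u0 k n j) kj_fin.
(* The quotient needs a nonzero denominator; the single term at time [h'] already makes it
   positive. *)
have b_gt0 : 0 < b.
  apply: lt_le_trans kj_gt0 _.
  apply: le_trans (_ : \sum_(i < h'.+1) u k i j <= b).
    by rewrite big_ord_recr /= lerDr sumr_ge0.
  by apply: (EFin_le_nneseries (fun n => u0 k n j)); rewrite kjE.
pose rho := reversible_weight r l.
have rho_gt0 n : 0 < rho n by exact: reversible_weight_gt0.
transitivity ((rho k / rho j)%:E).
  (* Reversibility is applied term by term and the constant taken out of the series. *)
  have -> : (\sum_(0 <= n <oo) (u j n k)%:E = (rho k / rho j)%:E * b%:E)%E.
    rewrite -kjE -nneseriesZl; last by move=> n _; rewrite lee_fin.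
    apply: eq_eseriesr => n _; rewrite -EFinM; congr (_%:E).
    rewrite mulrAC; apply: (canRL (mulfK (lt0r_neq0 (rho_gt0 j)))).
    by rewrite mulrC; exact: (weight_reversible a ok (detailed_balance hrates)).
  rewrite kjE -muleA divee ?mule1//.
  by rewrite eqe gt_eqF.
congr (_%:E).
have := reversible_weight_ratio hrates j `|k - j|%N.
have -> : j + `|k - j|%N%:Z = k by lia.
rewrite /rho => ->; rewrite mulrAC divff ?mul1r//.
exact: lt0r_neq0 (rho_gt0 j).
Qed.
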